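(* A graph $G$ is $12$-representable by a $121$-avoiding word if and only if $G$ is a permutation graph.
   Context: All graphs are finite, simple and undirected. Let $[n]=\{1,\ldots,n\}$. For a word $w$ over positive integers, $\mathrm{red}(w)$ is the word obtained from $w$ by replacing each occurrence of the $i$th smallest letter with $i$. For a word (pattern) $p=p_1\cdots p_k$ with $\mathrm{red}(p)=p$, a word $w=w_1\cdots w_\ell$ contains $p$ if there are indices $i_1<\cdots<i_k$ with $\mathrm{red}(w_{i_1}\cdots w_{i_k})=p$; otherwise $w$ avoids $p$ (is $p$-avoiding). A labeled graph with vertex set $[n]$ is $12$-represented by a word $w$ over $[n]$ containing at least one copy of each letter of $[n]$ if for all $i<j$ in $[n]$: $i$ and $j$ are adjacent if and only if every occurrence of $j$ precedes every occurrence of $i$ in $w$. An (unlabeled) graph on $n$ vertices is $12$-representable by a $p$-avoiding word if its vertices can be labeled bijectively by $[n]$ so that the resulting labeled graph is $12$-represented by some $p$-avoiding word. The permutation graph of a permutation $\pi$ of $[n]$ (written as a word) is the graph on $[n]$ in which $i<j$ are adjacent if and only if $j$ occurs before $i$ in $\pi$; a graph is a permutation graph if it is isomorphic to the permutation graph of some permutation. *)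

(* Defs.v *)
From mathcomp Require Import all_boot all_fingroup.

Set Implicit Arguments.
Unset Strict Implicit.
Unset Printing Implicit Defensive.

(* Words over the positive integers are sequences of natural numbers.  The
   vertex set [n] = {1, ..., n} is encoded by 'I_n, where i : 'I_n stands for
   the letter i.+1. *)

(* The rank of a letter x of w is the number of distinct letters of w that are
   at most x; it is i when x is the i-th smallest letter. *)
Definition red (w : seq nat) : seq nat :=
  [seq size (undup [seq y <- w | y <= x]) | x <- w].

Definition contains (p w : seq nat) : Prop :=
  exists2 s : seq nat, subseq s w & red s = p.

Definition avoids (p w : seq nat) : Prop := ~ contains p w.

Definition all_precede (w : seq nat) (x y : nat) : Prop :=
  forall a b : nat, a < size w -> b < size w ->
    nth 0 w a = x -> nth 0 w b = y -> a < b.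

Definition represents12 (n : nat) (w : seq nat) (e : rel 'I_n) : Prop :=
  (forall x : nat, (x \in w) = (1 <= x <= n)) /\
  (forall i j : 'I_n, i < j -> (e i j <-> all_precede w j.+1 i.+1)).

(* A bijection f : 'I_#|T| -> T assigns the label i.+1 to the vertex f i. *)
Definition representable12 (p : seq nat) (T : finType) (e : rel T) : Prop :=
  exists f : 'I_#|T| -> T, bijective f /\
  exists w : seq nat, represents12 w (relpre f e) /\ avoids p w.

Definition perm_word (n : nat) (pi : 'S_n) : seq nat :=
  [seq (pi i).+1 | i <- enum 'I_n].

Definition perm_graph (n : nat) (pi : 'S_n) : rel 'I_n :=
  fun i j =>
    let before x y := index x (perm_word pi) < index y (perm_word pi) in
    ((i < j) && before j.+1 i.+1) || ((j < i) && before i.+1 j.+1).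

Definition isomorphic (T U : finType) (e : rel T) (e' : rel U) : Prop :=
  exists f : T -> U, bijective f /\ forall x y : T, e' (f x) (f y) = e x y.

Definition is_permutation_graph (T : finType) (e : rel T) : Prop :=
  exists (n : nat) (pi : 'S_n), isomorphic e (perm_graph pi).

(* Main.v *)
Require Import Defs.
From mathcomp Require Import all_boot all_fingroup.

(** In a word [w] avoiding 121, no larger letter [j] can sit between two
    occurrences of a smaller letter [i], so each occurrence of [j] lies before
    all the [i]'s or after all of them.  Hence all [j]'s precede all [i]'s as
    soon as the last [j] precedes the last [i]
    ([avoids_121_all_precede]).  Adjacency thus depends only on the order of
    the last occurrences, and that order is recorded by [undup w], which keeps
    the last copy of each letter.  Since [undup w] lists each letter exactly
    once, it is the word of a permutation ([perm_word_onto]), whose permutation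
    graph is the graph represented by [w].

    Conversely the word of a permutation has no repeated letter, so it avoids
    121, and it is its own [undup]: the same statement
    ([represents12_iff_perm_graph]) shows that it represents its permutation
    graph. *)

Set Implicit Arguments.
Unset Strict Implicit.
Unset Printing Implicit Defensive.

(** [undup] retains last occurrences: when [x] comes before [y] in [undup w],
    the last [y] of [w] lies after every [x]. *)
Lemma index_undup_lt (w : seq nat) (x y a : nat) :
    index x (undup w) < index y (undup w) -> y \in w ->
    a < size w -> nth 0 w a = x ->
  exists b, [/\ a < b, b < size w & nth 0 w b = y].
Proof.
elim: w a => [//|z w IH] a /=; case: ifP => [zw | zNw].
- move=> lt_xy; rewrite inE => yzw.
  have yw : y \in w by case/predU1P: yzw => [->|].
  case: a => [_ /= zx | a lt_a /= wa].
  + have xw : x \in w by rewrite -zx.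
    have [|b [_ ltb wb]] := IH (index x w) lt_xy yw _ (nth_index 0 xw).
      by rewrite index_mem.
    by exists b.+1.
  + by have [b [? ? ?]] := IH a lt_xy yw lt_a wa; exists b.+1.
- rewrite /=; have [zy | zy] := eqVneq z y; first by rewrite ltn0.
  rewrite inE [y == z]eq_sym (negPf zy) /= => lt_xy yw.
  case: a => [_ /= _ | a lt_a /= wa].
    by exists (index y w).+1; split; rewrite /= ?ltnS ?index_mem ?nth_index.
  have xw : x \in w by rewrite -wa mem_nth.
  move: lt_xy; case: eqP => [zx | _]; first by rewrite zx xw in zNw.
  rewrite ltnS => lt_xy.
  by have [b [? ? ?]] := IH a lt_xy yw lt_a wa; exists b.+1.
Qed.

Lemma subseq_nth3 (w : seq nat) (a b c : nat) :
    a < b -> b < c -> c < size w ->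
  subseq [:: nth 0 w a; nth 0 w b; nth 0 w c] w.
Proof.
move=> ab bc cw; set s := [:: a; b; c].
have -> : [:: nth 0 w a; nth 0 w b; nth 0 w c] = [seq nth 0 w i | i <- s] by [].
rewrite -[X in subseq _ X](mkseq_nth 0) map_subseq //.
have -> : s = [seq i <- iota 0 (size w) | i \in s].
  apply: (irr_sorted_eq ltn_trans ltnn) => [||i].
  - by rewrite /= ab bc.
  - exact/(sorted_filter ltn_trans)/iota_ltn_sorted.
  - rewrite mem_filter mem_iota /= add0n; case si: (i \in s) => //=.
    have bw := ltn_trans bc cw; have aw := ltn_trans ab bw.
    by move: si; rewrite !inE => /or3P[] /eqP->.
exact: filter_subseq.
Qed.

Lemma red_121 (i j : nat) : i < j -> red [:: i; j; i] = [:: 1; 2; 1].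
Proof.
move=> ij; rewrite /red /= !leqnn (ltnW ij) leqNgt ij /=.
by rewrite !inE !eqxx /= (gtn_eqF ij) orbT.
Qed.

Lemma uniq_avoids_121 (w : seq nat) : uniq w -> avoids [:: 1; 2; 1] w.
Proof.
move=> uw [s /subseq_uniq/(_ uw)].
case: s => [|x [|y [|z [|? ?]]]] //= /and3P[xN _ _] [r1 r2 r3].
move: xN; rewrite !inE negb_or => /andP[xy xz].
(* The first and last letters are distinct, so both are at most the larger
   one, whose rank is therefore greater than 1. *)
case: (ltngtP x z) xz => // [xz | zx] _.
- by move: r3; rewrite leqnn (ltnW xz); case: (y <= z) => /=;
    rewrite !inE ?(ltn_eqF xz) ?orbF ?(negPf xy) //=; case: ifP.
- by move: r1; rewrite leqnn (ltnW zx); case: (y <= x) => /=;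
    rewrite !inE ?(gtn_eqF zx) ?orbF ?(negPf xy) //=; case: ifP.
Qed.

(** If the last [j] precedes the last [i] but some [i] precedes some [j], then
    that [i], that [j] and the last [i] form a copy of 121. *)
Lemma avoids_121_all_precede (w : seq nat) (i j : nat) :
    avoids [:: 1; 2; 1] w -> i < j -> i \in w -> j \in w ->
  all_precede w j i <-> index j (undup w) < index i (undup w).
Proof.
move=> av ij iw jw; split=> [prec | lt_ji].
- case: ltngtP => // [lt_ij | eq_ij].
  + have iw' : index i w < size w by rewrite index_mem.
    have [b [lt_b bw wb]] := index_undup_lt lt_ij jw iw' (nth_index 0 iw).
    by have := prec b _ bw iw' wb (nth_index 0 iw); rewrite ltnNge ltnW.
  + have jiE : j = i.
      by rewrite -(nth_index 0 (s := undup w) (x := j)) ?mem_undup // eq_ij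
                 nth_index ?mem_undup.
    by rewrite jiE ltnn in ij.
- move=> a b aw bw wa wb; case: ltngtP => // [lt_ba | eq_ab].
  + have [c [lt_ac cw wc]] := index_undup_lt lt_ji iw aw wa.
    case: av; exists [:: i; j; i]; last exact: red_121.
    by have := subseq_nth3 lt_ba lt_ac cw; rewrite wa wb wc.
  + by move: ij; rewrite -wa -wb eq_ab ltnn.
Qed.

Lemma perm_word_uniq (n : nat) (pi : 'S_n) : uniq (perm_word pi).
Proof.
rewrite map_inj_uniq ?enum_uniq // => i j [] /val_inj; exact: perm_inj.
Qed.

Lemma mem_perm_word (n : nat) (pi : 'S_n) (x : nat) :
  (x \in perm_word pi) = (1 <= x <= n).
Proof.
apply/mapP/idP => [[i _ ->] | ]; first by rewrite /= ltn_ord.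
case: x => // x /= xn; exists ((pi^-1)%g (Ordinal xn)).
  by rewrite mem_enum.
by rewrite permKV.
Qed.

Lemma perm_word_onto (n : nat) (u : seq nat) :
    uniq u -> (forall x, (x \in u) = (1 <= x <= n)) ->
  exists pi : 'S_n, perm_word pi = u.
Proof.
move=> uu memu.
have size_u : size u = n.
  rewrite -(size_iota 1 n); apply/perm_size/uniq_perm => [//||x].
    exact: iota_uniq.
  by rewrite memu mem_iota add1n.
have letter (i : 'I_n) : 1 <= nth 0 u i <= n.
  by rewrite -memu mem_nth ?size_u.
pose h (i : 'I_n) : 'I_n := insubd i (nth 0 u i).-1.
have hE i : (h i).+1 = nth 0 u i.
  by have := letter i; rewrite val_insubd; case: (nth 0 u i) => //= m ->.
have h_inj : injective h.
  move=> i j hij; apply/val_inj/eqP => /=.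
  by rewrite -(nth_uniq 0 _ _ uu) ?size_u ?ltn_ord // -!hE hij.
exists (perm h_inj); apply: (@eq_from_nth _ 0).
  by rewrite size_map size_enum_ord size_u.
move=> k; rewrite size_map size_enum_ord => kn.
by rewrite (nth_map (Ordinal kn)) ?size_enum_ord // permE hE nth_enum_ord.
Qed.

Lemma perm_graph_sym (n : nat) (pi : 'S_n) : symmetric (perm_graph pi).
Proof. by move=> i j; rewrite /perm_graph orbC. Qed.

Lemma perm_graph_irr (n : nat) (pi : 'S_n) : irreflexive (perm_graph pi).
Proof. by move=> i; rewrite /perm_graph ltnn. Qed.

Lemma perm_graph_lt (n : nat) (pi : 'S_n) (i j : 'I_n) : i < j ->
  perm_graph pi i j = (index j.+1 (perm_word pi) < index i.+1 (perm_word pi)).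
Proof. by move=> ij; rewrite /perm_graph ij [j < i]ltnNge (ltnW ij) orbF. Qed.

(** Stated for an arbitrary word rather than for [perm_word pi], so that it
    serves both to read a permutation off a representing word and to represent
    a given permutation graph. *)
Lemma represents12_iff_perm_graph (n : nat) (w : seq nat) (pi : 'S_n)
    (e : rel 'I_n) :
    symmetric e -> irreflexive e -> avoids [:: 1; 2; 1] w ->
    perm_word pi = undup w ->
  represents12 w e <-> e =2 perm_graph pi.
Proof.
move=> e_sym e_irr av piw.
have memw x : (x \in w) = (1 <= x <= n) by rewrite -mem_undup -piw mem_perm_word.
have prec (i j : 'I_n) : i < j -> all_precede w j.+1 i.+1 <-> perm_graph pi i j.
  move=> ij; rewrite perm_graph_lt // piw.
  by apply: avoids_121_all_precede; rewrite ?memw /=.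
split=> [[_ rep] | eE]; last first.
  by split=> // i j ij; rewrite eE; apply: iff_sym; apply: prec.
have lt_eq (i j : 'I_n) : i < j -> e i j = perm_graph pi i j.
  move=> ij; apply/idP/idP => [/(rep i j ij) | /(prec i j ij)].
    by move/(prec i j ij).
  by move/(rep i j ij).
move=> i j; case: (ltngtP i j) => [ | ji | /val_inj ->]; first exact: lt_eq.
  by rewrite e_sym perm_graph_sym lt_eq.
by rewrite e_irr perm_graph_irr.
Qed.

Theorem theorem16 (T : finType) (e : rel T)
    (e_sym : symmetric e) (e_irr : irreflexive e) :
  representable12 [:: 1; 2; 1] e <-> is_permutation_graph e.
Proof.
have sym_pre n (f : 'I_n -> T) : symmetric (relpre f e).
  by move=> i j; apply: e_sym.
have irr_pre n (f : 'I_n -> T) : irreflexive (relpre f e).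
  by move=> i; apply: e_irr.
split=> [[f [[g fK gK] [w [rep av]]]] | [n [pi [f [[g fK gK] iso]]]]].
- have memu x : (x \in undup w) = (1 <= x <= #|T|) by rewrite mem_undup rep.1.
  have [pi piw] := perm_word_onto (undup_uniq w) memu.
  exists #|T|, pi, g; split=> [|x y]; first by exists f.
  have eE := (represents12_iff_perm_graph
    (sym_pre _ f) (irr_pre _ f) av piw).1 rep.
  by rewrite -eE /= !gK.
- have nT : n = #|T| by rewrite -(card_ord n) (bij_eq_card (Bijective fK gK)).
  subst n; exists g; split; first by exists f.
  have av := uniq_avoids_121 (perm_word_uniq pi).
  exists (perm_word pi); split=> //.
  have piw : perm_word pi = undup (perm_word pi).
    by rewrite undup_id ?perm_word_uniq.
  apply/(represents12_iff_perm_graph (sym_pre _ g) (irr_pre _ g) av piw) => i j.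
  by rewrite /= -iso !gK.
Qed.
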